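(* Let $p$ be a prime and let $k\in\mathbb{N}$. Then, as $x$ ranges over $\mathbb{N}$, $g(p^k,x)$ assumes only two distinct values. Specifically, for every $x\in\mathbb{N}$, $$g(p^k,x)=\begin{cases} g(p^k,0) & \text{if } p\mid x,\\ g(p^k,1) & \text{otherwise.}\end{cases}$$
   Context: $\mathbb{N}$ denotes the positive integers and $\mathbb{Z}_n=\mathbb{Z}/n\mathbb{Z}$. $GL_3(\mathbb{Z}_n)$ is the group of invertible $3\times 3$ matrices over $\mathbb{Z}_n$. For a $3\times 3$ matrix $M=[m_{ij}]$, the permanent is $\mathrm{perm}(M)=\sum_{\sigma\in S_3}\prod_{i=1}^3 m_{i\sigma(i)}$. For a positive integer $n$ and an integer $x$, $g(n,x)$ denotes the cardinality of the set $G(n,x)=\{M\in GL_3(\mathbb{Z}_n)\mid \mathrm{perm}(M)\equiv x \pmod n\}$. *)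

(* Defs.v *)
From HB Require Import structures.
From mathcomp Require Import all_boot all_order all_fingroup all_algebra.

Set Implicit Arguments.
Unset Strict Implicit.
Unset Printing Implicit Defensive.

Import GRing.Theory.
Local Open Scope ring_scope.

Definition permanent (R : comNzRingType) (m : nat) (M : 'M[R]_m) : R :=
  \sum_(s : 'S_m) \prod_(i < m) M i (s i).

(* ['Z_n] is Z/nZ only when [1 < n] (['Z_0] and ['Z_1] are both Z/2Z), so
   [permG] and [permg] are only meaningful for such n. *)
Definition permG (n : nat) (x : int) : {set {'GL_3['Z_n]}} :=
  [set M : {'GL_3['Z_n]} | permanent (GLval M) == x%:~R].

Definition permg (n : nat) (x : int) : nat := #|permG n x|.

(* Main.v *)
(* Let f be the reduction of R = Z/p^k onto its residue field F. Invertible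
   matrices with a given permanent x are counted by N_R(x).
   - Multiplying a row by a unit u shows N_R(u x) = N_R(x).
   - If the determinant is a unit, some permanental 2x2 minor is a unit; changing
     the opposite entry by an element of the maximal ideal moves the permanent
     by any prescribed element of that ideal, so N_R(x) depends on f x only.
   - Counting the fibres of reduction, N_R(0) <> N_R(1) follows from
     N_F(0) < N_F(1). For the latter, fix the two lower rows and let u, v be the
     vectors of cofactors and permanental cofactors of the top row. If v is not a
     multiple of u, translating the top row by w with w.u = 0, w.v = 1 matches
     permanents 0 and 1. Otherwise permanent 0 and u <> 0 force v = 0, hence a zero
     column in the lower rows, and the matrices with such a column are more
     numerous for permanent 1 than for permanent 0. *)

Require Import Defs.
From HB Require Import structures.
From mathcomp Require Import all_boot all_order all_fingroup all_algebra.
From mathcomp Require Import ring.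

Set Implicit Arguments.
Unset Strict Implicit.
Unset Printing Implicit Defensive.

Import GRing.Theory.
Local Open Scope ring_scope.

(** * Permanents, with explicit formulas in size 3 *)

Lemma permanent_row0 (R : comNzRingType) (n : nat) (M : 'M[R]_n.+1) :
  permanent M = \sum_j M 0 j * permanent (row' 0 (col' j M)).
Proof.
rewrite /permanent (partition_big (fun s : 'S_n.+1 => s 0) predT) //=.
apply: eq_bigr => j0 _; rewrite (reindex (lift_perm 0 j0)) /=; last first.
  (* [ulsf] deletes [i] and its image from [s] and renumbers the rest; for [i = 0] this inverts
     [lift_perm 0 j0] on the permutations sending 0 to [j0]. *)
  pose ulsf i (s : 'S_n.+1) k := odflt k (unlift (s i) (s (lift i k))).
  have ulsfK i (s : 'S_n.+1) k : lift (s i) (ulsf i s k) = s (lift i k).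
    rewrite /ulsf; have := neq_lift i k.
    by rewrite -(can_eq (permK s)) => /unlift_some[] ? ? ->.
  have inj_ulsf s : injective (ulsf 0 s).
    by move=> k l /(congr1 (lift (s 0))); rewrite !ulsfK => /perm_inj /lift_inj.
  exists (fun s => perm (inj_ulsf s)) => [s _ | s /eqP s0].
    by apply/permP=> k; rewrite permE /ulsf lift_perm_lift lift_perm_id liftK.
  apply/permP=> k; case: (unliftP 0 k) => [l|] ->; rewrite ?lift_perm_id //.
  by rewrite lift_perm_lift -s0 permE ulsfK.
rewrite big_distrr /=; apply: eq_big => [s | s _].
  by rewrite lift_perm_id eqxx.
rewrite big_ord_recl lift_perm_id; congr (_ * _).
by apply: eq_bigr => i _; rewrite !mxE lift_perm_lift.
Qed.

Lemma permanent_map (R S : comNzRingType) (f : {rmorphism R -> S}) (n : nat)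
    (M : 'M[R]_n) : permanent (map_mx f M) = f (permanent M).
Proof.
rewrite /permanent rmorph_sum; apply: eq_bigr => s _.
by rewrite rmorph_prod; apply: eq_bigr => i _; rewrite mxE.
Qed.

Definition mx3 (R : nzRingType) (x y z a b c d e g : R) : 'M[R]_3 :=
  \matrix_(i, j)
    nth 0 (nth [::] [:: [:: x; y; z]; [:: a; b; c]; [:: d; e; g]] i) j.

Variant mx3_spec (R : nzRingType) : 'M[R]_3 -> Type :=
  Mx3Spec x y z a b c d e g : mx3_spec (mx3 x y z a b c d e g).

Lemma mx3_eta (R : nzRingType) (M : 'M[R]_3) :
  M = mx3 (M 0 0) (M 0 1) (M 0 2%:R) (M 1 0) (M 1 1) (M 1 2%:R)
          (M 2%:R 0) (M 2%:R 1) (M 2%:R 2%:R).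
Proof.
apply/matrixP => -[[|[|[|i]]] lti] [[|[|[|j]]] ltj] //;
by rewrite mxE /=; congr (M _ _); apply: val_inj.
Qed.

Lemma mx3P (R : nzRingType) (M : 'M[R]_3) : mx3_spec M.
Proof. by rewrite [M]mx3_eta. Qed.

Lemma mx3_inj (R : nzRingType) (x y z a b c d e g x' y' z' a' b' c' d' e' g' : R) :
  mx3 x y z a b c d e g = mx3 x' y' z' a' b' c' d' e' g' ->
  [/\ [/\ x = x', y = y' & z = z'], [/\ a = a', b = b' & c = c']
    & [/\ d = d', e = e' & g = g']].
Proof.
move=> /matrixP E; split; split;
 [ have := E 0 0 | have := E 0 1 | have := E 0 2%:R | have := E 1 0
 | have := E 1 1 | have := E 1 2%:R | have := E 2%:R 0 | have := E 2%:R 1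
 | have := E 2%:R 2%:R ]; by rewrite !mxE.
Qed.

Lemma permanent_mx3 (R : comNzRingType) (x y z a b c d e g : R) :
  permanent (mx3 x y z a b c d e g)
  = x * (b * g + c * e) + y * (c * d + a * g) + z * (a * e + b * d).
Proof.
have perm0 (A : 'M[R]_0) : permanent A = 1.
  rewrite /permanent (big_pred1 1%g) ?big_ord0 // => s.
  by apply/esym/eqP/permP => -[].
rewrite !(permanent_row0, big_ord_recl, big_ord0, perm0) !mxE /=.
by ring.
Qed.

Lemma det_mx3 (R : comNzRingType) (x y z a b c d e g : R) :
  \det (mx3 x y z a b c d e g)
  = x * (b * g - c * e) + y * (c * d - a * g) + z * (a * e - b * d).
Proof.
rewrite (expand_det_row _ 0) /cofactor.
do !rewrite ?big_ord_recl ?big_ord0 ?(expand_det_row _ 0) /cofactor ?det_mx00.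
rewrite !mxE /=.
by ring.
Qed.

(** * Permanental cofactors *)

(** The permanent of the minor opposite [(i, j)], written over permutations of the full index set,
    so that row [i] visibly does not occur. *)
Definition pcofactor (R : comNzRingType) (n : nat) (M : 'M[R]_n) (i j : 'I_n) : R :=
  \sum_(s : 'S_n | s i == j) \prod_(k | k != i) M k (s k).

Lemma pcofactor_map (R S : comNzRingType) (f : {rmorphism R -> S}) (n : nat)
    (M : 'M[R]_n) (i j : 'I_n) : pcofactor (map_mx f M) i j = f (pcofactor M i j).
Proof.
rewrite /pcofactor rmorph_sum; apply: eq_bigr => s _.
by rewrite rmorph_prod; apply: eq_bigr => k _; rewrite mxE.
Qed.

Lemma pcofactorD_delta (R : comNzRingType) (n : nat) (M : 'M[R]_n) (i j : 'I_n) (t : R) :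
  pcofactor (M + t *: delta_mx i j) i j = pcofactor M i j.
Proof.
apply: eq_bigr => s _; apply: eq_bigr => k /negPf nki.
by rewrite !mxE nki mulr0 addr0.
Qed.

Lemma permanentD_delta (R : comNzRingType) (n : nat) (M : 'M[R]_n) (i j : 'I_n) (t : R) :
  permanent (M + t *: delta_mx i j) = permanent M + t * pcofactor M i j.
Proof.
rewrite /permanent /pcofactor big_distrr /= [X in _ = _ + X]big_mkcond -big_split /=.
apply: eq_bigr => s _; rewrite (bigD1 i) //= [in RHS](bigD1 i) //= !mxE eqxx /=.
rewrite (eq_bigr (fun k => M k (s k))) => [|k /negPf nki]; last first.
  by rewrite !mxE nki mulr0 addr0.
by case: eqP => _; rewrite ?mulr1 ?mulr0 ?addr0 // mulrDl.
Qed.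

Lemma pcofactor_mx3 (R : comNzRingType) (x y z a b c d e g : R) :
  \matrix_(i, j) pcofactor (mx3 x y z a b c d e g) i j
  = mx3 (b * g + c * e) (a * g + c * d) (a * e + b * d)
        (y * g + z * e) (x * g + z * d) (x * e + y * d)
        (y * c + z * b) (x * c + z * a) (x * b + y * a).
Proof.
(* A permanental cofactor is the growth of the permanent when its entry grows by 1, which reduces
   all nine formulas to [permanent_mx3]. *)
have pE i j (M : 'M[R]_3) :
    pcofactor M i j = permanent (M + 1 *: delta_mx i j) - permanent M.
  by rewrite permanentD_delta mul1r addrC addKr.
apply/matrixP => -[[|[|[|i]]] lti] [[|[|[|j]]] ltj] //; rewrite mxE pE.
all: rewrite [_ + _ *: _]mx3_eta [in RHS]mxE /= !permanent_mx3 !mxE /=.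
all: ring.
Qed.

(** Only polynomial identities with integer coefficients are used, without dividing by 2 or 3, so
    every characteristic is covered. *)
Lemma pcofactor_neq0 (F : fieldType) (M : 'M[F]_3) :
  \det M != 0 -> exists ij, pcofactor M ij.1 ij.2 != 0.
Proof.
move=> detM; case: (pickP (fun ij => pcofactor M ij.1 ij.2 != 0)) => [ij|no].
  by exists ij.
have pc0 i j : pcofactor M i j = 0 by have /negbFE/eqP := no (i, j).
case: (mx3P M) detM pc0 => x y z a b c d e g detM pc0; case/negP: detM.
have /matrixP pcE := pcofactor_mx3 x y z a b c d e g.
have := (pcE 0 0, pcE 0 1, pcE 0 2%:R, pcE 1 1, pcE 2%:R 0, pcE 2%:R 1,
  pcE 2%:R 2%:R).
rewrite !mxE !pc0 /= => -[[[[[[P00 P01] P02] P11] P20] P21] P22].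
(* All six terms of [\det] are, up to sign, [x * b * g], and the signs make
   [\det = 6 * (x * b * g)]; the square of that term is killed by 2. *)
have xbg2 : 2 * (x * b * g) ^+ 2 = 0.
  have xbc : 2 * (x * b * c) = 0.
    transitivity
      (c * (x * b + y * a) - a * (y * c + z * b) + b * (x * c + z * a)).
      by ring.
    by rewrite -P20 -P21 -P22; ring.
  transitivity
    (2 * (x * b * g) * x * (b * g + c * e) - 2 * (x * b * c) * x * e * g).
    by ring.
  by rewrite -P00 xbc; ring.
have det6 : \det (mx3 x y z a b c d e g) = 6 * (x * b * g).
  transitivity (6 * (x * b * g) - x * (b * g + c * e) + y * (a * g + c * d)
     + z * (a * e + b * d) - 2 * g * (x * b + y * a) - 2 * b * (x * g + z * d)).
    by rewrite det_mx3; ring.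
  by rewrite -P00 -P01 -P02 -P11 -P22; ring.
rewrite -sqrf_eq0 det6 (_ : _ ^+ 2 = 18 * (2 * (x * b * g) ^+ 2)); last by ring.
by rewrite xbg2 mulr0.
Qed.

(** * Counting by permanent over a local ring and its residue field *)

Lemma permanent_diag_mul (R : comNzRingType) (n : nat) (d : 'rV[R]_n) (M : 'M[R]_n) :
  permanent (diag_mx d *m M) = (\prod_i d 0 i) * permanent M.
Proof.
rewrite /permanent big_distrr /=; apply: eq_bigr => s _.
by rewrite -big_split; apply: eq_bigr => i _; rewrite mul_diag_mx mxE.
Qed.

(** A set of plain matrices rather than of elements of the unit group, so that row changes and
    entrywise reduction apply directly. *)
Definition permset (R : finComUnitRingType) (x : R) : {set 'M[R]_3} :=
  [set M | (M \in unitmx) && (permanent M == x)].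
Arguments permset {R} x%_R.

(** Scaling the top row is left multiplication by an invertible diagonal matrix, hence injective;
    scaling by the inverse of [u] gives the other inequality. *)
Lemma card_permset_unitM (R : finComUnitRingType) (u x : R) :
  u \is a GRing.unit -> #|permset (u * x)| = #|permset x|.
Proof.
have le (v y : R) : v \is a GRing.unit -> (#|permset y| <= #|permset (v * y)|)%N.
  move=> vU; pose d : 'rV[R]_3 := \row_i if i == 0 then v else 1.
  have prodd : \prod_i d 0 i = v.
    rewrite big_ord_recl !mxE /= big1 ?mulr1 // => i _.
    by rewrite !mxE.
  have dU : diag_mx d \in unitmx by rewrite unitmxE det_diag prodd.
  rewrite -(card_imset (mem (permset y)) (can_inj (mulKmx dU))).
  apply/subset_leq_card/subsetP => _ /imsetP[M /[!inE]/andP[MU /eqP <-] ->].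
  by rewrite unitmx_mul dU MU permanent_diag_mul prodd eqxx.
move=> uU; apply/eqP; rewrite eqn_leq le // andbT.
by rewrite -[X in (_ <= #|permset X|)%N](mulKr uU) le ?unitrV.
Qed.

(** Hypothesis [fU] says that the non-units of [R] are exactly the kernel of [f], so [R] is local
    with that kernel as maximal ideal. *)
Lemma unitmx_map (R : finComUnitRingType) (F : finFieldType)
    (f : {rmorphism R -> F}) (fU : forall x, (x \is a GRing.unit) = (f x != 0))
    (n : nat) (M : 'M[R]_n) : (map_mx f M \in unitmx) = (M \in unitmx).
Proof. by rewrite !unitmxE fU det_map_mx unitfE. Qed.

Lemma card_permset_residue (R : finComUnitRingType) (F : finFieldType)
    (f : {rmorphism R -> F}) (fU : forall x, (x \is a GRing.unit) = (f x != 0))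
    (x y : R) : f x = f y -> #|permset x| = #|permset y|.
Proof.
suff le (a b : R) : f a = f b -> (#|permset a| <= #|permset b|)%N.
  by move=> fxy; apply/eqP; rewrite eqn_leq !le.
move=> fab.
(* A position with nonzero permanental cofactor over [F]; the default [(0, 0)] is taken only when
   all of them vanish, which invertibility excludes. *)
pose sel (N : 'M[F]_3) : 'I_3 * 'I_3 :=
  odflt (0, 0) [pick ij | pcofactor N ij.1 ij.2 != 0].
pose cof (M : 'M[R]_3) := let ij := sel (map_mx f M) in pcofactor M ij.1 ij.2.
(* The cofactor at [ij] does not involve the entry [ij], and [ij] is read off
   [map_mx f M], which [phi] does not change. *)
pose phi (M : 'M[R]_3) := let ij := sel (map_mx f M) in
  M + ((b - a) / cof M) *: delta_mx ij.1 ij.2.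
have f_phi M : map_mx f (phi M) = map_mx f M.
  by rewrite map_mxD map_mxZ rmorphM rmorphB fab subrr mul0r scale0r addr0.
have cof_phi M : cof (phi M) = cof M.
  by rewrite /cof f_phi pcofactorD_delta.
have cofU M : M \in unitmx -> cof M \is a GRing.unit.
  rewrite -(unitmx_map fU) unitmxE unitfE => /pcofactor_neq0[ij nz].
  rewrite fU -pcofactor_map /sel; case: pickP => [//|/(_ ij)].
  by rewrite nz.
have phi_inj : injective phi.
  move=> M N eqMN; have fMN : map_mx f M = map_mx f N by rewrite -(f_phi M) eqMN f_phi.
  have cMN : cof M = cof N by rewrite -(cof_phi M) eqMN cof_phi.
  by move: eqMN; rewrite /phi cMN fMN => /addIr.
rewrite -(card_imset (mem (permset a)) phi_inj).
apply/subset_leq_card/subsetP => _ /imsetP[M /[!inE]/andP[MU /eqP Ma] ->].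
rewrite -(unitmx_map fU) f_phi (unitmx_map fU) MU /= permanentD_delta Ma.
by rewrite divrK ?cofU // addrC subrK.
Qed.

(** Each fibre of entrywise reduction is a translate of the kernel by a lift. *)
Lemma card_preimset_map_mx (R : finComUnitRingType) (F : finFieldType)
    (f : {rmorphism R -> F}) (f_surj : forall y, exists x, f x = y)
    (m n : nat) (X : {set 'M[F]_(m, n)}) :
  #|[set M | map_mx f M \in X]|
  = (#|X| * #|[set M : 'M[R]_(m, n) | map_mx f M == 0%R]|)%N.
Proof.
have lift N : exists M : 'M[R]_(m, n), map_mx f M == N.
  have surj y : exists x, f x == y by have [x <-] := f_surj y; exists x.
  exists (map_mx (fun y => xchoose (surj y)) N).
  by apply/eqP/matrixP => i j; rewrite !mxE; apply/eqP/(xchooseP (surj _)).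
rewrite -sum1_card (partition_big (map_mx f) [in X]) => [|M]; last by rewrite inE.
rewrite -sum_nat_const; apply: eq_bigr => N NX; have [L /eqP fL] := lift N.
rewrite -sum1_card (reindex (+%R^~ L)) /=; last first.
  by exists (fun M => M - L) => M _; rewrite ?addrK ?subrK.
apply: eq_bigl => M; rewrite !inE map_mxD fL -subr_eq0 addrK.
by case: eqP => [->|]; rewrite ?andbF // add0r NX.
Qed.

(** Counts twice the matrices over [R] whose reduction lies in [permset (f x)]: by their reductions,
    and by their permanents, which run through the fibre of [f] over [f x] with equally many
    matrices for each value. *)
Lemma card_permset_map (R : finComUnitRingType) (F : finFieldType)
    (f : {rmorphism R -> F}) (fU : forall x, (x \is a GRing.unit) = (f x != 0))
    (f_surj : forall y, exists x, f x = y) (x : R) :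
  (#|permset (f x)| * #|[set M : 'M[R]_3 | map_mx f M == 0%R]|
   = #|[set y | f y == 0%R]| * #|permset x|)%N.
Proof.
rewrite -card_preimset_map_mx // -sum1_card.
rewrite (partition_big (@permanent _ _) [in [set y | f y == f x]]) => [|M]; last first.
  by rewrite !inE permanent_map => /andP[].
rewrite (eq_bigr (fun=> #|permset x|)) => [|y /[!inE]/eqP fy]; last first.
  rewrite sum1dep_card -(card_permset_residue fU fy); congr #|pred_of_set _|.
  apply/setP => M; rewrite !inE (unitmx_map fU) permanent_map -andbA.
  by congr andb; case: (permanent M =P y) => [->|]; rewrite ?andbF // fy eqxx.
rewrite sum_nat_const; congr muln.
rewrite -!sum1_card (reindex (+%R^~ x)) /=; last first.
  by exists (fun y => y - x) => y _; rewrite ?addrK ?subrK.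
by apply: eq_bigl => y; rewrite !inE rmorphD -[f y == 0](inj_eq (addIr (f x))) add0r.
Qed.

(** * Shifting one row while keeping the determinant *)

Lemma expand_permanent_row (R : comNzRingType) (n : nat) (M : 'M[R]_n) (i : 'I_n) :
  permanent M = \sum_j M i j * pcofactor M i j.
Proof.
rewrite /permanent (partition_big (fun s : 'S_n => s i) predT) //=.
apply: eq_bigr => j _; rewrite /pcofactor big_distrr /=.
by apply: eq_bigr => s /eqP <-; rewrite (bigD1 i).
Qed.

Lemma pcofactorD_row (R : comNzRingType) (n : nat) (M : 'M[R]_n) (i j : 'I_n)
    (w : 'rV[R]_n) :
  pcofactor (M + delta_mx i 0 *m w) i j = pcofactor M i j.
Proof.
apply: eq_bigr => s _; apply: eq_bigr => k /negPf nki.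
by rewrite !mxE big_ord1 !mxE nki mul0r addr0.
Qed.

Lemma cofactorD_row (R : comNzRingType) (n : nat) (M : 'M[R]_n) (i j : 'I_n)
    (w : 'rV[R]_n) :
  cofactor (M + delta_mx i 0 *m w) i j = cofactor M i j.
Proof.
rewrite /cofactor; congr (_ * \det _); apply/matrixP => k l.
by rewrite !mxE big_ord1 !mxE eq_sym (negPf (neq_lift _ _)) mul0r addr0.
Qed.

Lemma permanentD_row (R : comNzRingType) (n : nat) (M : 'M[R]_n) (i : 'I_n)
    (w : 'rV[R]_n) :
  permanent (M + delta_mx i 0 *m w)
  = permanent M + \sum_j w 0 j * pcofactor M i j.
Proof.
rewrite !(expand_permanent_row _ i) -big_split; apply: eq_bigr => j _ /=.
by rewrite pcofactorD_row !mxE big_ord1 mxE !eqxx mul1r mulrDl.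
Qed.

Lemma detD_row (R : comNzRingType) (n : nat) (M : 'M[R]_n) (i : 'I_n)
    (w : 'rV[R]_n) :
  \det (M + delta_mx i 0 *m w) = \det M + \sum_j w 0 j * cofactor M i j.
Proof.
rewrite !(expand_det_row _ i) -big_split; apply: eq_bigr => j _ /=.
by rewrite cofactorD_row !mxE big_ord1 mxE !eqxx mul1r mulrDl.
Qed.

Lemma permanent_col_perm (R : comNzRingType) (n : nat) (s : 'S_n) (M : 'M[R]_n) :
  permanent (col_perm s M) = permanent M.
Proof.
rewrite [RHS]/permanent (reindex_inj (mulIg s)); apply: eq_bigr => t _ /=.
by apply: eq_bigr => i _; rewrite mxE permM.
Qed.

(* Adding such a [w] to row [i] keeps the determinant and adds 1 to the
   permanent. *)
Definition row_shiftable (R : finComUnitRingType) (n : nat) (i : 'I_n) :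
    {set 'M[R]_n} :=
  [set M | [exists w : 'rV[R]_n, (\sum_j w 0 j * cofactor M i j == 0)
                             && (\sum_j w 0 j * pcofactor M i j == 1)]].

(** The shift vector is picked by a test on the cofactors along row [i] alone. These ignore row [i],
    so the shifted matrix picks the same vector and the shift can be undone. *)
Lemma leq_card_row_shiftable (R : finComUnitRingType) (i : 'I_3) (x : R) :
  (#|permset x :&: row_shiftable R i| <= #|permset (x + 1) :&: row_shiftable R i|)%N.
Proof.
pose good (M : 'M[R]_3) (w : 'rV[R]_3) := (\sum_j w 0 j * cofactor M i j == 0)
  && (\sum_j w 0 j * pcofactor M i j == 1).
have goodD (M : 'M[R]_3) (v : 'rV[R]_3) : good (M + delta_mx i 0 *m v) =1 good M.
  move=> w; rewrite /good.
  have -> : \sum_j w 0 j * cofactor (M + delta_mx i 0 *m v) i j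
            = \sum_j w 0 j * cofactor M i j.
    by apply: eq_bigr => j _; rewrite cofactorD_row.
  have -> // : \sum_j w 0 j * pcofactor (M + delta_mx i 0 *m v) i j
            = \sum_j w 0 j * pcofactor M i j.
  by apply: eq_bigr => j _; rewrite pcofactorD_row.
pose w M := odflt 0 [pick w | good M w].
have wP M : M \in row_shiftable R i -> good M (w M).
  by rewrite inE /w => /existsP[v gv]; case: pickP => [//|/(_ v)]; rewrite [good _ _]gv.
pose phi M := M + delta_mx i 0 *m w M.
have w_phi M : w (phi M) = w M by rewrite /w (eq_pick (goodD _ _)).
have phi_inj : injective phi.
  by move=> M N eqMN; move: (eqMN); rewrite /phi -(w_phi M) eqMN w_phi => /addIr.
rewrite -(card_imset (mem (permset x :&: _)) phi_inj).
apply/subset_leq_card/subsetP => _ /imsetP[M /setIP[xM sM] ->].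
have /andP[/eqP w0 /eqP w1] := wP _ sM; move: xM; rewrite !inE => /andP[MU /eqP <-].
rewrite unitmxE detD_row w0 addr0 -unitmxE MU permanentD_row w1 eqxx /=.
by apply/existsP; exists (w M); rewrite -/(good _ _) goodD wP.
Qed.

Lemma pcofactor_row_eq0 (F : finFieldType) (n : nat) (M : 'M[F]_n) (i j : 'I_n) :
  \det M != 0 -> permanent M = 0 -> M \notin row_shiftable F i ->
  pcofactor M i j = 0.
Proof.
move=> dM pM; apply: contraNeq => nz; rewrite inE; apply/existsP.
(* Row [i] pairs with its cofactors to [\det M] and with its permanental cofactors to 0. Subtracting
   this multiple of it from the [j]-th unit vector kills the first pairing and leaves
   [pcofactor M i j] in the second, which is then scaled to 1. *)
exists ((pcofactor M i j)^-1 *: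
  (delta_mx 0 j - (cofactor M i j / \det M) *: row i M)).
have sumE (c : 'I_n -> F) :
    \sum_l ((pcofactor M i j)^-1 *:
      (delta_mx 0 j - (cofactor M i j / \det M) *: row i M)) 0 l * c l
    = (pcofactor M i j)^-1 *
      (c j - cofactor M i j / \det M * \sum_l M i l * c l).
  have deltaE : \sum_l (l == j)%:R * c l = c j.
    rewrite (bigD1 j) //= eqxx mul1r big1 ?addr0 // => l /negPf ->.
    by rewrite mul0r.
  rewrite -[c j in RHS]deltaE mulrBr !big_distrr /=.
  rewrite -sumrB; apply: eq_bigr => l _; rewrite !mxE eqxx /=; ring.
rewrite !sumE -expand_det_row -expand_permanent_row pM divfK // subrr mulr0 eqxx.
by rewrite mulr0 subr0 mulVf ?eqxx.
Qed.

(** * Matrices with a column vanishing below the top row *)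

Definition zero_below_col (F : finFieldType) (j : 'I_3) : {set 'M[F]_3} :=
  [set M : 'M[F]_3 | (M 1 j == 0) && (M 2%:R j == 0)].

(** Swapping two columns preserves invertibility and the permanent. *)
Lemma card_permset_zero_below_col (F : finFieldType) (x : F) (j l : 'I_3) :
  #|permset x :&: zero_below_col F j| = #|permset x :&: zero_below_col F l|.
Proof.
have le i k :
    (#|permset x :&: zero_below_col F i| <= #|permset x :&: zero_below_col F k|)%N.
  have xK : involutive (@xcol F 3 3 i k).
    by move=> M; rewrite /xcol -col_permM tperm2 col_perm1.
  rewrite -(card_imset (mem (permset x :&: _)) (inv_inj xK)).
  apply/subset_leq_card/subsetP => _ /imsetP[M + ->].
  rewrite !inE !mxE tpermR /xcol permanent_col_perm col_permE unitmx_mul.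
  by rewrite unitmx_perm andbT.
by apply/eqP; rewrite eqn_leq !le.
Qed.

Lemma mem_zero_below_col2 (F : finFieldType) (p x y z a b c d e g : F) :
  (mx3 x y z a b c d e g \in permset p :&: zero_below_col F 2%:R)
  = [&& c == 0, g == 0, z != 0, a * e - b * d != 0 & z * (a * e + b * d) == p].
Proof.
rewrite !inE unitmxE unitfE det_mx3 permanent_mx3 !mxE /=.
case: (c =P 0) => [->|_]; last by rewrite andbF.
case: (g =P 0) => [->|_]; last by rewrite !andbF.
rewrite !(oppr0, mulr0, mul0r, addr0, subr0, add0r) mulf_eq0 negb_or.
by rewrite /= !andbT andbA.
Qed.

Lemma ltn_card_permset_zero_below_col (F : finFieldType) :
  (#|permset (0 : F) :&: zero_below_col F 2%:R|
   < #|permset (1 : F) :&: zero_below_col F 2%:R|)%N.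
Proof.
(* In the shape [[x y z] [a b 0] [d e 0]], membership in the first set means
   [a * e = - (b * d)] with [z, a, b, d] nonzero, so [e] is redundant and [z]
   is stored in its place, while the new corner entry is forced by the value 1
   of the permanent; if [z] would make the lower left block singular or of zero
   permanent, one of [d], [e] is set to 0 instead. *)
pose sel (a b d z : F) :=
  if a * z == b * d then (d, 0) else if a * z == - (b * d) then (0, z) else (d, z).
pose phi (M : 'M[F]_3) :=
  let de := sel (M 1 0) (M 1 1) (M 2%:R 0) (M 0 2%:R) in
  mx3 (M 0 0) (M 0 1) (M 1 0 * de.2 + M 1 1 * de.1)^-1
      (M 1 0) (M 1 1) 0 de.1 de.2 0.
have phiE x y z a b c d e g : phi (mx3 x y z a b c d e g)
    = mx3 x y (a * (sel a b d z).2 + b * (sel a b d z).1)^-1 a b 0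
          (sel a b d z).1 (sel a b d z).2 0.
  by rewrite /phi !mxE.
have P0 x y z a b c d e g :
    mx3 x y z a b c d e g \in permset 0 :&: zero_below_col F 2%:R ->
    [/\ c = 0, g = 0, a * e = - (b * d) & [&& a != 0, b != 0, d != 0 & z != 0]].
  rewrite mem_zero_below_col2 => /and5P[/eqP c0 /eqP g0 z0 nz].
  rewrite mulf_eq0 (negPf z0) addr_eq0 => /eqP aebd; split=> //.
  rewrite andbT; move: nz; rewrite aebd -opprD oppr_eq0.
  have [a0|//] := eqVneq a 0.
    by have /esym/eqP := aebd; rewrite a0 mul0r oppr_eq0 => /eqP ->; rewrite addr0 eqxx.
  have [->|//] := eqVneq b 0; first by rewrite mul0r addr0 eqxx.
  by have [->|//] := eqVneq d 0; first by rewrite mulr0 addr0 eqxx.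
have phi_inj : {in permset 0 :&: zero_below_col F 2%:R &, injective phi}.
  move=> M N; case: (mx3P M) => x y z a b c d e g.
  case: (mx3P N) => x' y' z' a' b' c' d' e' g'.
  move=> /P0[-> -> ae /and4P[a0 b0 d0 z0]] /P0[-> -> ae' /and4P[_ _ d'0 z'0]].
  rewrite !phiE => /mx3_inj[[<- <- _] [eqa eqb _] [eqd eqe _]].
  rewrite -eqa -eqb in ae' eqd eqe *.
  suff [dd zz] : d = d' /\ z = z'.
    by congr (mx3 _ _ _ _ _ _ _ _ _) => //; apply: (mulfI a0); rewrite ae ae' dd.
  (* As [d] and [z] are nonzero, the zero pattern of the stored pair reveals which branch of [sel]
     was used. In the first two branches the lost entry is recovered from [a * z = b * d] or
     [a * z = - (b * d)]. *)
  move: eqd eqe; rewrite /sel; case: eqP => [az|_]; last case: eqP => [az|_];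
    (case: eqP => [az'|_]; last case: eqP => [az'|_]) => /= eqd eqe; split=> //;
    try (by move: d0 d'0 z0 z'0; rewrite ?eqd ?eqe -?eqd -?eqe ?eqxx).
  - by apply: (mulfI a0); rewrite az az' eqd.
  - by apply: (mulfI b0); apply: oppr_inj; rewrite -az -az' eqe.
rewrite -(card_in_imset phi_inj); apply/proper_card/properP; split.
  apply/subsetP => _ /imsetP[M + ->].
  case: (mx3P M) => x y z a b c d e g /P0[_ _ _ /and4P[a0 b0 d0 z0]].
  rewrite phiE mem_zero_below_col2 !eqxx /=.
  have /andP[nzp nzm] : (a * (sel a b d z).2 + b * (sel a b d z).1 != 0)
      && (a * (sel a b d z).2 - b * (sel a b d z).1 != 0).
    rewrite /sel; case: (a * z =P b * d) => [_|/eqP n1] /=.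
      by rewrite !mulr0 add0r sub0r oppr_eq0 mulf_eq0 negb_or b0 d0.
    case: (a * z =P - (b * d)) => [_|/eqP n2] /=.
      by rewrite !mulr0 addr0 subr0 mulf_eq0 negb_or a0 z0.
    by rewrite addr_eq0 n2 subr_eq0 n1.
  by rewrite invr_eq0 nzp nzm mulVf ?eqxx.
(* This matrix has [a = 0], whereas [phi] keeps [a], which is nonzero throughout the first set. *)
exists (mx3 0 0 1 0 1 0 1 0 0).
  rewrite mem_zero_below_col2 !(mulr0, mul0r, mulr1, sub0r, add0r, oppr_eq0).
  by rewrite ?eqxx ?oner_eq0.
apply/imsetP => -[M]; case: (mx3P M) => x y z a b c d e g /P0[_ _ _ /and4P[a0 _ _ _]].
by rewrite phiE => /mx3_inj[_ [a0' _ _] _]; rewrite -a0' eqxx in a0.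
Qed.

(** Determinant and permanent are both multiples of the top entry of column [j]. A shift that keeps
    the nonzero determinant keeps this entry, hence also the permanent. *)
Lemma zero_below_col_not_shiftable (F : finFieldType) (j : 'I_3) (M : 'M[F]_3) :
  \det M != 0 -> M \in zero_below_col F j -> M \notin row_shiftable F 0.
Proof.
move=> dM Mj; apply/negP; rewrite inE => /existsP[w /andP[/eqP w0 /eqP w1]].
have := detD_row M 0 w; have := permanentD_row M 0 w; rewrite w0 w1 addr0.
case: (mx3P M) dM Mj => x y z a b c d e g dM Mj.
have -> : mx3 x y z a b c d e g + delta_mx 0 0 *m w
          = mx3 (x + w 0 0) (y + w 0 1) (z + w 0 2%:R) a b c d e g.
  apply/matrixP => -[[|[|[|?]]] ?] [[|[|[|?]]] ?] //;
  rewrite !mxE big_ord1 !mxE /= ?mul1r ?mul0r ?addr0 //;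
  by congr (_ + w _ _); apply: val_inj.
move: Mj dM; rewrite !permanent_mx3 !det_mx3 !inE !mxE.
by case: j => -[|[|[|j]]] ltj //= /andP[/eqP -> /eqP ->];
  rewrite !(mul0r, mulr0, addr0, add0r, oppr0, subr0, sub0r) => dM pE /eqP;
  rewrite -subr_eq0 -mulrBl mulf_eq0 (addrC _ (w _ _)) addrK;
  (case/orP => [/eqP w_eq0|/eqP h];
    first by move/eqP: pE;
      rewrite w_eq0 addr0 -subr_eq0 opprD addNKr oppr_eq0 oner_eq0);
  rewrite h mulr0 eqxx in dM.
Qed.

(** Two such columns would confine both lower rows to a single column, making them dependent. *)
Lemma zero_below_col_uniq (F : finFieldType) (i j : 'I_3) (M : 'M[F]_3) :
  \det M != 0 -> M \in zero_below_col F i -> M \in zero_below_col F j -> i = j.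
Proof.
case: (mx3P M) => x y z a b c d e g; rewrite det_mx3 !inE !mxE => dM.
case: i j => -[|[|[|i]]] lti [[|[|[|j]]] ltj] //=
  /andP[/eqP p1 /eqP p2] /andP[/eqP p3 /eqP p4];
  solve [exact: val_inj
        | by rewrite ?p1 ?p2 ?p3 ?p4 !(mul0r, mulr0, addr0, subr0, oppr0) eqxx in dM].
Qed.

(** The permanental cofactors of the top row vanish, so each ordinary one is, up to sign, twice a
    product such as [2 * b * g], and some such product is nonzero. Then [2 * b * g * d = 0] gives
    [d = 0], and [a * g + c * d = 0] gives [a = 0]; the other two cases are alike. *)
Lemma ex_zero_below_col (F : finFieldType) (M : 'M[F]_3) :
  M \in permset 0 -> M \notin row_shiftable F 0 ->
  exists j, M \in zero_below_col F j.
Proof.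
rewrite inE unitmxE unitfE => /andP[dM /eqP pM] nC.
have := pcofactor_row_eq0 _ dM pM nC.
case: (mx3P M) dM => x y z a b c d e g dM /= pc0.
have /matrixP pcE := pcofactor_mx3 x y z a b c d e g.
have := pcE 0 0; have := pcE 0 1; have := pcE 0 2%:R; rewrite !mxE !pc0 /=.
move=> /esym E2 /esym E1 /esym E0.
have aeg : 2 * a * g * e = 0.
  transitivity (g * (a * e + b * d) + e * (a * g + c * d) - d * (b * g + c * e)).
    by ring.
  by rewrite E0 E1 E2; ring.
have bgd : 2 * b * g * d = 0.
  transitivity (d * (b * g + c * e) + g * (a * e + b * d) - e * (a * g + c * d)).
    by ring.
  by rewrite E0 E1 E2; ring.
have [u0|u0] := eqVneq (b * g - c * e) 0; last first.
  have bg0 : 2 * b * g != 0.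
    by rewrite (_ : 2 * b * g = b * g - c * e + (b * g + c * e));
      [rewrite E0 addr0 | ring].
  exists 0; move/eqP: bgd E1; rewrite mulf_eq0 (negPf bg0) => /eqP ->.
  move: bg0; rewrite !inE !mxE /= !mulf_eq0 !negb_or => /andP[_ g0].
  by rewrite mulr0 addr0 => /eqP; rewrite mulf_eq0 (negPf g0) orbF => ->; rewrite eqxx.
have [u1|u1] := eqVneq (c * d - a * g) 0; last first.
  have ag0 : 2 * a * g != 0.
    by rewrite (_ : 2 * a * g = a * g + c * d - (c * d - a * g));
      [rewrite E1 sub0r oppr_eq0 | ring].
  exists 1; move/eqP: aeg E0; rewrite mulf_eq0 (negPf ag0) => /eqP ->.
  move: ag0; rewrite !inE !mxE /= !mulf_eq0 !negb_or => /andP[_ g0].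
  by rewrite mulr0 addr0 => /eqP; rewrite mulf_eq0 (negPf g0) orbF => ->; rewrite eqxx.
have ae0 : 2 * a * e != 0.
  have u2 : a * e - b * d != 0.
    by apply: contraNneq dM => u2; rewrite det_mx3 u0 u1 u2 !mulr0 !addr0.
  by rewrite (_ : 2 * a * e = a * e - b * d + (a * e + b * d)); [rewrite E2 addr0 | ring].
exists 2%:R; move/eqP: aeg E0; rewrite mulrAC mulf_eq0 (negPf ae0) => /eqP ->.
move: ae0; rewrite !inE !mxE /= !mulf_eq0 !negb_or => /andP[_ e0].
by rewrite mulr0 add0r => /eqP; rewrite mulf_eq0 (negPf e0) orbF => ->; rewrite eqxx.
Qed.

(** Shiftable matrices are compared by the row shift. The other ones of permanent 0 are covered by
    the three sets [Z 0 j], while the sets [Z 1 j] are disjoint and contain no shiftable matrix; the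
    strict inequality for one column, taken three times, decides. *)
Lemma ltn_card_permset_field (F : finFieldType) :
  (#|permset (0 : F)| < #|permset (1 : F)|)%N.
Proof.
pose Z x j := permset (x : F) :&: zero_below_col F j.
have ZE x j : #|Z x j| = #|Z x 2%:R| by exact: card_permset_zero_below_col.
rewrite -(cardsID (row_shiftable F 0) (permset 0)).
rewrite -(cardsID (row_shiftable F 0) (permset 1)).
rewrite -addnS leq_add //.
  by have := leq_card_row_shiftable 0 (0 : F); rewrite add0r.
have le0 : (#|permset 0 :\: row_shiftable F 0%R| <= \sum_j #|Z 0%R j|)%N.
  apply: leq_trans (_ : _ <= #|\bigcup_j Z 0%R j|)%N _.
    apply/subset_leq_card/subsetP => M /setDP[M0 nC].
    have [j Mj] := ex_zero_below_col M0 nC.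
    by apply/bigcupP; exists j; rewrite // inE M0.
  elim/big_rec2: _ => [|j n A _ le]; first by rewrite cards0.
  by apply: leq_trans (leq_card_setU _ _) _; rewrite leq_add2l.
have le1 : (\sum_j #|Z 1%R j| <= #|permset 1 :\: row_shiftable F 0%R|)%N.
  (* Counting matrix by matrix, each [M] lies in at most one [Z 1 j]. *)
  have dZ M j : M \in Z 1 j -> \det M != 0.
    by rewrite !inE unitmxE unitfE => /andP[/andP[]].
  rewrite -[X in (_ <= X)%N]sum1_card.
  under eq_bigr => j _ do rewrite -sum1_card big_mkcond.
  rewrite exchange_big [X in (_ <= X)%N]big_mkcond /=; apply: leq_sum => M _.
  case: (pickP (fun j => M \in Z 1 j)) => [j Mj|no]; last first.
    by rewrite big1 // => j _; rewrite no.
  rewrite (bigD1 j) //= Mj big1 => [|i].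
    have := Mj; rewrite inE in_setD => /andP[-> /zero_below_col_not_shiftable -> //].
    exact: dZ Mj.
  apply: contraNeq; case: ifP => // Mi _; apply/eqP.
  move: (Mi) (Mj); rewrite !in_setI => /andP[_ Zi] /andP[_ Zj].
  exact: zero_below_col_uniq (dZ _ _ Mi) Zi Zj.
apply: leq_ltn_trans le0 (leq_trans _ le1).
rewrite (eq_bigr (fun=> #|Z 0%R 2%:R|)) //.
rewrite [X in (_ < X)%N](eq_bigr (fun=> #|Z 1%R 2%:R|)) //.
by rewrite !sum_nat_const card_ord ltn_mul2l ltn_card_permset_zero_below_col.
Qed.

(** * Integers modulo a prime power, and the conclusion *)

Lemma permgE (n : nat) (x : int) : permg n x = #|permset (x%:~R : 'Z_n)|.
Proof.
rewrite /permg -(card_imset _ (val_inj : injective (@GLval 3 'Z_n))).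
apply: eq_card => M; rewrite inE; apply/imsetP/andP => [[u] | [MU Mx]].
  by rewrite inE => ux ->; split=> //; exact: (valP u).
by exists (FinRing.Unit (MU : M \is a GRing.unit)); rewrite ?inE.
Qed.

(** Reduction is defined on representatives. Since [p] divides [p ^ k], it sends the class of any
    natural number to its class modulo [p], whence the morphism laws; units are the classes prime to
    [p]. *)
Lemma Zp_residue (p k : nat) : prime p -> (0 < k)%N ->
  exists f : {rmorphism 'Z_(p ^ k) -> 'F_p},
    (forall x, (x \is a GRing.unit) = (f x != 0)) /\ (forall y, exists x, f x = y).
Proof.
move=> p_pr k_gt0; set n := (p ^ k)%N.
have n_gt1 : (1 < n)%N by rewrite -(expn0 p) ltn_exp2l ?prime_gt1.
pose f (x : 'Z_n) : 'F_p := (x : nat)%:R.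
have f_nat m : f m%:R = m%:R.
  by rewrite /f val_Zp_nat // -(Fp_nat_mod p_pr) modn_dvdm ?dvdn_exp // Fp_nat_mod.
have fD x y : f (x + y) = f x + f y.
  by rewrite -[x]natr_Zp -[y]natr_Zp -natrD !f_nat natrD.
have fB : zmod_morphism f.
  by move=> x y; apply/eqP; rewrite -(inj_eq (addIr (f y))) -fD !subrK.
have fM : monoid_morphism f.
  split=> [|x y]; first by rewrite -[1]/(1%:R) f_nat.
  by rewrite -[x]natr_Zp -[y]natr_Zp -natrM !f_nat natrM.
pose fA := GRing.isZmodMorphism.Build _ _ f fB.
pose fMm := GRing.isMonoidMorphism.Build _ _ f fM.
exists (HB.pack f fA fMm : {rmorphism 'Z_n -> 'F_p}); split=> [x | y] /=.
  by rewrite -{1}[x]natr_Zp unitZpE // coprime_pexpl // -(unitFpE p_pr) unitfE.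
by exists (y : nat)%:R; rewrite f_nat natr_Zp.
Qed.

(** Counts over [R] and [F] are proportional, with factors independent of the permanent and a kernel
    that is nonempty, so equality over [R] would descend to [F]. *)
Lemma card_permset01_neq (R : finComUnitRingType) (F : finFieldType)
    (f : {rmorphism R -> F}) (fU : forall x, (x \is a GRing.unit) = (f x != 0))
    (f_surj : forall y, exists x, f x = y) :
  #|permset (0 : R)| != #|permset (1 : R)|.
Proof.
apply/eqP => eq01.
have := card_permset_map fU f_surj 0; have := card_permset_map fU f_surj 1.
rewrite -eq01 (rmorph0 f) (rmorph1 f) => <- /eqP; rewrite eqn_pmul2r.
  by rewrite ltn_eqF // ltn_card_permset_field.
by rewrite card_gt0; apply/set0Pn; exists 0; rewrite inE map_mx0.
Qed.

Theorem theorem2 (p k : nat) (p_prime : prime p) (k_gt0 : (0 < k)%N) :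
  (exists a b : nat,
      a <> b /\
      forall v : nat,
        (exists x : nat, (0 < x)%N /\ permg (p ^ k)%N x%:Z = v)
        <-> (v = a \/ v = b))
  /\
  (forall x : nat, (0 < x)%N ->
     permg (p ^ k)%N x%:Z =
       if (p %| x)%N then permg (p ^ k)%N 0%:Z else permg (p ^ k)%N 1%:Z).
Proof.
have [f [fU f_surj]] := Zp_residue p_prime k_gt0.
have f_nat m : f m%:R = m%:R by exact: rmorph_nat.
have values x : permg (p ^ k)%N x%:Z =
    if (p %| x)%N then permg (p ^ k)%N 0%:Z else permg (p ^ k)%N 1%:Z.
  rewrite !permgE -!pmulrn; case: ifPn => px.
    apply: (card_permset_residue fU); rewrite !f_nat.
    by apply/eqP; rewrite -(dvdn_pcharf (pchar_Fp p_prime)).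
  rewrite -[x%:R]mulr1 card_permset_unitM // fU f_nat.
  by rewrite -(dvdn_pcharf (pchar_Fp p_prime)).
have neq : permg (p ^ k)%N 0%:Z <> permg (p ^ k)%N 1%:Z.
  by rewrite !permgE; apply/eqP; apply: card_permset01_neq fU f_surj.
split=> [|x _]; last exact: values.
exists (permg (p ^ k)%N 0%:Z), (permg (p ^ k)%N 1%:Z); split=> // v; split.
  by case=> x [_ <-]; rewrite values; case: ifP; [left | right].
(* As [x] must be positive, the value at 0 is attained at [p]. *)
case=> ->; [exists p | exists 1%N]; split=> //; first exact: prime_gt0.
by rewrite values dvdnn.
Qed.
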